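(* For every integer $t\geq 4$, every graph $G$ that does not contain $K_t$ as a minor is $(t-1)$-colourable with defect $t-2$.
   Context: All graphs are finite and simple. A graph $G$ is $k$-colourable with defect $d$ if each vertex can be assigned one of $k$ colours (not necessarily properly) such that each vertex is adjacent to at most $d$ vertices of its own colour, i.e. each monochromatic subgraph has maximum degree at most $d$. *)

(* Defs.v *)
From mathcomp Require Import all_boot.
Set Implicit Arguments.
Unset Strict Implicit.
Unset Printing Implicit Defensive.

Record sgraph := SGraph {
  vertex :> finType;
  edge : rel vertex;
  edge_sym : symmetric edge;
  edge_irrefl : irreflexive edge }.

Section Complete.
Variable n : nat.
Definition complete_rel : rel 'I_n := fun i j => i != j.
Lemma complete_sym : symmetric complete_rel.
Proof. by move=> i j; rewrite /complete_rel eq_sym. Qed.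
Lemma complete_irrefl : irreflexive complete_rel.
Proof. by move=> i; rewrite /complete_rel eqxx. Qed.
Definition complete_graph := SGraph complete_sym complete_irrefl.
End Complete.

(* The subgraph of G induced by A is nonempty and connected. *)
Definition connected_in (G : sgraph) (A : {set G}) : Prop :=
  A != set0 /\
  {in A &, forall x y,
     connect [rel u v | [&& u \in A, v \in A & edge u v]] x y}.

(* H is a minor of G. B h is the branch set of the vertex h, that is, the set
   of vertices of G contracted to h; vertices of G in no branch set are
   deleted, as are edges of G between branch sets of nonadjacent vertices. *)
Definition minor (H G : sgraph) : Prop :=
  exists B : H -> {set G},
    [/\ forall h, connected_in (B h),
        forall h1 h2, h1 != h2 -> [disjoint B h1 & B h2]
      & forall h1 h2, edge h1 h2 ->
          exists x y, [/\ x \in B h1, y \in B h2 & edge x y]].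

Definition colourable_with_defect (G : sgraph) (k d : nat) : Prop :=
  exists c : {ffun G -> 'I_k},
    forall v, #|[set w | edge v w && (c w == c v)]| <= d.

(* Main.v *)
Require Import Defs.
From mathcomp Require Import all_boot.
Set Implicit Arguments.
Unset Strict Implicit.
Unset Printing Implicit Defensive.

(** Partition the graph greedily into connected parts, so that any two parts
    adjacent to the same connected set of uncovered vertices are adjacent to each
    other. Let C be a component of the uncovered vertices. It forms a clique
    minor together with the parts adjacent to it, so there are at most t - 2 of
    these; pick in C one neighbour of each. Some connected subset H of C contains
    the picked vertices and induces maximum degree at most their number. Take H
    as the next part, and give it a colour unused on the parts adjacent to C. *)

(** * Connected sets and components of induced subgraphs *)

Lemma connect_ind_closed (T : finType) (e : rel T) (P : T -> Prop) x y :
  (forall u v, P u -> e u v -> P v) -> P x -> connect e x y -> P y.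
Proof.
move=> closP Px /connectP [p]; elim: p x Px => [|z p IH] x Px /=.
  by move=> _ ->.
by case/andP=> xz; apply: IH; apply: closP xz.
Qed.

Section Connectivity.
Variable G : sgraph.
Implicit Types (A C D H T X Y : {set G}) (P Q : {set {set G}}).

Definition erel A := [rel u v | [&& u \in A, v \in A & @edge G u v]].

Lemma erel_sym A : symmetric (erel A).
Proof. by move=> u v /=; rewrite edge_sym andbCA. Qed.

Lemma connected_in_root A v :
  v \in A -> {in A, forall x, connect (erel A) v x} -> connected_in A.
Proof.
move=> vA h; split=> [|x y xA yA]; first by apply/set0Pn; exists v.
apply: connect_trans (h y yA).
by rewrite (sym_connect_sym (@erel_sym A)) h.
Qed.

Definition comp A v : {set G} := [set x in A | connect (erel A) v x].

Lemma comp_sub A v : comp A v \subset A.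
Proof. by apply/subsetP=> x; rewrite inE => /andP[]. Qed.

Lemma comp_root A v : v \in A -> v \in comp A v.
Proof. by move=> vA; rewrite inE vA connect0. Qed.

Lemma comp_closed A v x y :
  x \in comp A v -> y \in A -> edge x y -> y \in comp A v.
Proof.
rewrite !inE => /andP[xA vx] yA xy; rewrite yA.
by apply: connect_trans vx _; apply: connect1; rewrite /= xA yA.
Qed.

Lemma comp_connected A v : v \in A -> connected_in (comp A v).
Proof.
move=> vA; apply: (connected_in_root (comp_root vA)) => x.
rewrite inE => /andP[_ vx].
pose S y := y \in comp A v /\ connect (erel (comp A v)) v y.
suff [] : S x by [].
apply: (connect_ind_closed (P := S)) vx; last first.
  by rewrite /S comp_root ?connect0.
move=> y z [yC vy] /= /and3P[_ zA yz].
have zC := comp_closed yC zA yz; split=> //.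
by apply: connect_trans vy _; apply: connect1; rewrite /= yC zC.
Qed.

Lemma connected_in_sub A v (S : {set G}) :
  connected_in A -> v \in A -> v \in S ->
  (forall x y, x \in S -> y \in A -> edge x y -> y \in S) -> A \subset S.
Proof.
move=> [_ cA] vA vS closS; apply/subsetP=> y yA.
apply: (connect_ind_closed (P := fun y => y \in S)) (cA v y vA yA) => //.
by move=> u w uS /= /and3P[_ wA uw]; apply: closS uw.
Qed.

(* Every neighbour [u] of [v] separates [v] from some [s] in [T]. Two distinct
   neighbours cannot separate [v] from the same [s], since each is still joined
   to [v] by an edge when the other is deleted. *)
Lemma degree_le_of_separated C T v :
  connected_in C -> T \subset C -> v \in C ->
  (forall u, u \in C -> edge v u -> ~~ (T \subset comp (C :\ u) v)) ->
  #|[set w in C | edge v w]| <= #|T|.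
Proof.
move=> cC TC vC sep.
(* [g u] is a vertex of [T] that [u] separates from [v]; by [sep], the default [v] is never taken at
   a neighbour [u] of [v] in [C]. *)
pose g u := odflt v [pick s in T | s \notin comp (C :\ u) v].
have gP u : u \in C -> edge v u -> g u \in T /\ g u \notin comp (C :\ u) v.
  move=> uC vu; rewrite /g; case: pickP => [s /andP[] //|none].
  case/negP: (sep u uC vu); apply/subsetP=> s sT.
  by have := none s; rewrite sT => /negbFE.
rewrite -(card_in_imset (f := g)) => [|u u']; last first.
  rewrite !inE => /andP[uC vu] /andP[u'C vu'] eqg.
  apply/eqP; apply: contraT => neq.
  have [gT gu] := gP u uC vu; have [_] := gP u' u'C vu'; rewrite -eqg => gu'.
  have vC' w : edge v w -> v \in C :\ w.
    by rewrite !inE vC andbT => vw; apply/eqP=> E; rewrite E edge_irrefl in vw.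
  suff /subsetP/(_ _ (subsetP TC _ gT)) :
      C \subset comp (C :\ u) v :|: comp (C :\ u') v.
    by rewrite inE (negPf gu) (negPf gu').
  apply: (connected_in_sub cC vC); first by rewrite inE comp_root ?vC'.
  (* The component avoiding [a] can be left inside [C] only through [a], and [a], being a neighbour
     of [v], lies in the component avoiding [b]. *)
  have step a b x y : edge v a -> edge v b -> a \in C -> a != b ->
      x \in comp (C :\ a) v -> y \in C -> edge x y ->
      (y \in comp (C :\ a) v) || (y \in comp (C :\ b) v).
    move=> va vb aC ab xa yC xy; have [->|ya] := eqVneq y a.
      rewrite (comp_closed (comp_root (vC' _ vb)) _ va) ?orbT //.
      by rewrite !inE ab.
    by rewrite (comp_closed xa _ xy) // !inE ya.
  move=> x y; rewrite !in_setU => /orP[] xS yC xy; first exact: step xy.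
  by rewrite orbC; apply: step xy; rewrite // eq_sym.
by apply/subset_leq_card/subsetP=> s /imsetP[u]; rewrite inE => /andP[uC vu] ->;
  case: (gP u uC vu).
Qed.

(** Induction on the size of [C]: while some edge [vu] of [C] allows [u] to be deleted with [T]
    still inside the component of [v], pass to that component. Once no such edge is left, every
    vertex of [C] satisfies the separation hypothesis of [degree_le_of_separated]. *)
Lemma connected_hull C T :
  connected_in C -> T \subset C ->
  exists H, [/\ connected_in H, T \subset H, H \subset C
    & {in H, forall v, #|[set w in H | edge v w]| <= #|T|}].
Proof.
have [n] := ubnP #|C|; elim: n C => // n IH C leC cC TC.
have [/existsP[v /existsP[u /and4P[vC uC vu Tsub]]]|nosep] :=
    boolP [exists v, exists u,
      [&& v \in C, u \in C, edge v u & T \subset comp (C :\ u) v]].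
  have subC : comp (C :\ u) v \subset C :\ u := comp_sub _ _.
  have vCu : v \in C :\ u.
    by rewrite !inE vC andbT; apply/eqP=> E; rewrite E edge_irrefl in vu.
  have [|H [cH TH HC degH]] := IH _ _ (comp_connected vCu) Tsub.
    apply: leq_ltn_trans (subset_leq_card subC) _.
    by rewrite [#|C|](cardsD1 u) uC in leC.
  exists H; split=> //; apply: subset_trans HC _.
  exact: subset_trans subC (subsetDl _ _).
exists C; split=> // v vC; apply: degree_le_of_separated => // u uC vu.
apply: contra nosep => Tsub; apply/existsP; exists v; apply/existsP; exists u.
by rewrite vC uC vu.
Qed.

(** * Adjacency of vertex sets and clique minors *)

Definition adj X Y := [exists x in X, exists y in Y, @edge G x y].

Lemma adjP X Y :
  reflect (exists x y, [/\ x \in X, y \in Y & edge x y]) (adj X Y).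
Proof.
apply: (iffP exists_inP) => [[x xX /exists_inP[y yY xy]]|[x [y [xX yY xy]]]].
  by exists x, y.
by exists x => //; apply/exists_inP; exists y.
Qed.

Lemma adj_sym X Y : adj X Y = adj Y X.
Proof.
by apply/adjP/adjP=> -[x [y [xX yY xy]]]; exists y, x; rewrite edge_sym.
Qed.

Lemma adjS X Y (Z : {set G}) : Y \subset Z -> adj X Y -> adj X Z.
Proof.
move=> /subsetP YZ /adjP[x [y [xX yY xy]]]; apply/adjP.
by exists x, y; rewrite YZ.
Qed.

Lemma complete_minor n Q :
  n <= #|Q| -> {in Q, forall X, connected_in X} ->
  {in Q &, forall X Y, X != Y -> [disjoint X & Y] && adj X Y} ->
  minor (complete_graph n) G.
Proof.
move=> nQ cQ pQ; pose B (i : complete_graph n) := nth set0 (enum Q) i.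
have ltQ (i : 'I_n) : i < size (enum Q).
  by rewrite -cardE; apply: leq_trans nQ.
have BQ i : B i \in Q by rewrite -mem_enum mem_nth.
have Bneq i j : i != j -> B i != B j.
  by apply: contra => /eqP/uniqP E; apply/eqP/val_inj/E;
    rewrite ?enum_uniq ?inE ?ltQ.
exists B; split=> [i|i j ij|i j ij]; first exact: cQ.
  by have /andP[] := pQ _ _ (BQ i) (BQ j) (Bneq i j ij).
by have /andP[_ /adjP] := pQ _ _ (BQ i) (BQ j) (Bneq i j ij).
Qed.

(** * Greedy construction of the coloured partition *)

Variables (k d : nat).

Definition good_partial P (f : {set G} -> 'I_k) :=
  [/\ {in P &, forall X Y, X != Y -> [disjoint X & Y]},
      {in P, forall X, connected_in X
         /\ {in X, forall v, #|[set w in X | edge v w]| <= d}},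
      {in P &, forall X Y, X != Y -> adj X Y -> f X != f Y}
    & forall D, connected_in D -> [disjoint D & cover P] ->
        {in P &, forall X Y, X != Y -> adj X D -> adj Y D -> adj X Y}].

Lemma card_adj_parts P f C :
  ~ minor (complete_graph d.+2) G -> good_partial P f ->
  connected_in C -> [disjoint C & cover P] ->
  #|[set X in P | adj X C]| <= d.
Proof.
move=> noK [disjP cP _ adjPP] cC CP; rewrite leqNgt; apply/negP=> big.
have dC X : X \in P -> [disjoint C & X].
  by move=> XP; apply: disjointWr CP; apply: bigcup_sup.
(* [C] is nonempty and uncovered, so it adds one more branch set to the [d.+1] parts supposed
   adjacent to it. *)
have CnP : C \notin P.
  apply/negP=> /dC; rewrite -setI_eq0 setIid => /eqP C0.
  by case: cC; rewrite C0 eqxx.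
apply: noK; apply: (complete_minor (Q := C |: [set X in P | adj X C])).
- by rewrite cardsU1 inE (negPf CnP).
- move=> X; rewrite !inE => /orP[/eqP-> //|/andP[XP _]].
  by case: (cP X XP).
- move=> X Y; rewrite !inE.
  move=> /orP[/eqP->|/andP[XP XC]] /orP[/eqP->|/andP[YP YC]] neq.
  + by rewrite eqxx in neq.
  + by rewrite dC // adj_sym.
  + by rewrite disjoint_sym dC.
  + by rewrite disjP // (adjPP C).
Qed.

Lemma good_partial_extend P f x :
  d < k -> ~ minor (complete_graph d.+2) G -> good_partial P f ->
  x \notin cover P ->
  exists H g, [/\ H != set0, [disjoint H & cover P] & good_partial (H |: P) g].
Proof.
move=> dk noK good xP; have [disjP cP fP adjPP] := good.
have xU : x \in ~: cover P by rewrite inE.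
pose C := comp (~: cover P) x; pose Q := [set X in P | adj X C].
have cC : connected_in C := comp_connected xU.
have CP : [disjoint C & cover P] by rewrite disjoints_subset comp_sub.
have cardQ : #|Q| <= d by exact: (card_adj_parts noK good).
(* [r X] is a neighbour in [C] of the part [X]; the default [x] occurs only for sets not adjacent to
   [C]. *)
pose r X := odflt x [pick y in C | [exists z in X, edge z y]].
have rP X : adj X C -> r X \in C /\ exists2 z, z \in X & edge z (r X).
  move=> /adjP[z [y [zX yC zy]]]; rewrite /r; case: pickP => [w|none].
    by move=> /= /andP[wC /exists_inP].
  have := none y; rewrite /= yC => /exists_inP[].
  by exists z.
have TC : r @: Q \subset C.
  by apply/subsetP=> s /imsetP[X]; rewrite inE => /andP[_ /rP[rC _]] ->.
have [H [cH TH HC degH]] := connected_hull cC TC.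
have HP : [disjoint H & cover P] by apply: disjointWl CP.
(* Containing the vertices [r X], the set [H] keeps every adjacency between a part and [C]. *)
have QH X : X \in P -> adj X C -> adj X H.
  move=> XP XC; have [_ [z zX zr]] := rP X XC; apply/adjP.
  exists z, (r X); split=> //; apply: (subsetP TH); apply: imset_f.
  by rewrite inE XP.
(* The parts in [Q] use at most [d] of the [k] colours, and [d < k]. *)
have [a aQ] : exists a, a \notin f @: Q.
  have : #|f @: Q| < #|'I_k|.
    rewrite card_ord; apply: leq_ltn_trans dk.
    exact: leq_trans (leq_imset_card _ _) cardQ.
  by rewrite ltnNge; case: (pickP [pred a | a \notin f @: Q]) => [a ? _|none];
    [exists a | case/negP; apply/subset_leq_card/subsetP=> a _; apply/negbFE/none].
have H0 : H != set0 by case: cH.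
have dH X : X \in P -> [disjoint H & X].
  by move=> XP; apply: disjointWr HP; apply: bigcup_sup.
have neH X : X \in P -> X == H = false.
  move=> XP; apply: contraNF H0 => /eqP E.
  by have := dH X XP; rewrite E -setI_eq0 setIid.
have aP X : X \in P -> adj X H -> f X != a.
  move=> XP XH; apply: contra aQ => /eqP <-; apply: imset_f.
  by rewrite inE XP (adjS HC).
exists H, (fun X => if X == H then a else f X); split=> //; split.
- move=> X Y; rewrite !inE => /orP[/eqP->|XP] /orP[/eqP->|YP] neq.
  + by rewrite eqxx in neq.
  + exact: dH.
  + by rewrite disjoint_sym dH.
  + exact: disjP.
- move=> X; rewrite !inE => /orP[/eqP->|/cP //]; split=> // v vH.
  apply: leq_trans (degH v vH) _.
  exact: leq_trans (leq_imset_card _ _) cardQ.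
- move=> X Y; rewrite !inE => /orP[/eqP->|XP] /orP[/eqP->|YP] neq.
  + by rewrite eqxx in neq.
  + by rewrite eqxx neH // adj_sym eq_sym => /(aP Y YP).
  + by rewrite eqxx neH // => /(aP X XP).
  + by rewrite !neH //; apply: fP.
- move=> D cD; rewrite /cover bigcup_setU big_set1 -/(cover P) => DHP.
  have DP : [disjoint D & cover P] by apply: disjointWr DHP; apply: subsetUr.
  (* [C] is a full component of the uncovered vertices, so a connected uncovered [D] touching [H]
     lies in [C]. A part touching [D] then touches [C], hence [H] by [QH]. *)
  have DC : adj D H -> D \subset C.
    move=> /adjP[z [h [zD hH zh]]]; have DU := DP.
    rewrite disjoints_subset in DU.
    apply: (connected_in_sub cD zD) => [|u w uC wD].
      apply: comp_closed (subsetP HC _ hH) _ _; first exact: (subsetP DU).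
      by rewrite edge_sym.
    by apply: comp_closed => //; apply: (subsetP DU).
  move=> X Y; rewrite !inE => /orP[/eqP->|XP] /orP[/eqP->|YP] neq.
  + by rewrite eqxx in neq.
  + rewrite adj_sym => /DC DsubC YD; rewrite adj_sym.
    by apply: QH => //; apply: adjS YD.
  + move=> XD; rewrite adj_sym => /DC DsubC.
    by apply: QH => //; apply: adjS XD.
  + exact: adjPP.
Qed.

(** Each extension covers a nonempty set of new vertices, so the number of uncovered ones drops. *)
Lemma good_partial_total P f :
  d < k -> ~ minor (complete_graph d.+2) G -> good_partial P f ->
  exists Q g, good_partial Q g /\ cover Q = setT.
Proof.
move=> dk noK; have [n] := ubnP #|~: cover P|; elim: n P f => // n IH P f leP good.
have [full|[x]] := set_0Vmem (~: cover P).
  by exists P, f; split=> //; rewrite -[cover P]setCK full setC0.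
rewrite inE => xP.
have [H [g [H0 HP goodH]]] := good_partial_extend dk noK good xP.
apply: IH goodH; rewrite ltnS in leP; apply: leq_trans leP.
apply: proper_card; rewrite properE setCS /cover bigcup_setU big_set1 subsetUr.
rewrite setCS subUset negb_and; apply/orP; left.
apply: contra H0; rewrite -/(cover P) => /setIidPl <-.
by rewrite setI_eq0.
Qed.

(** Every vertex takes the colour of its part. Adjacent parts differ in colour, so neighbours of
    equal colour share a part, where degrees are at most [d]. *)
Lemma defective_of_total P f :
  good_partial P f -> cover P = setT -> colourable_with_defect G k d.
Proof.
move=> [disjP cP fP _] full.
have inb v : v \in pblock P v by rewrite mem_pblock full inE.
have bP v : pblock P v \in P by rewrite pblock_mem // full inE.
exists [ffun v => f (pblock P v)] => v.
have [_ /(_ v (inb v))] := cP _ (bP v); apply: leq_trans.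
apply/subset_leq_card/subsetP=> w; rewrite !inE !ffunE => /andP[vw /eqP E].
rewrite vw andbT; have [<- //|neq] := eqVneq (pblock P w) (pblock P v).
have := fP _ _ (bP w) (bP v) neq; rewrite E eqxx => /(_ _)/negP[] //.
by apply/adjP; exists w, v; rewrite edge_sym.
Qed.

End Connectivity.

Theorem theorem2 (t : nat) (ht : 4 <= t) (G : sgraph)
    (hG : ~ minor (complete_graph t) G) :
  colourable_with_defect G (t - 1) (t - 2).
Proof.
(* With [t] written as [d.+2], there are [d.+1] colours and defect [d]; the construction starts from
   the empty partition. *)
case: t ht hG => [|[|d]] // _ noK; rewrite subn1 !subSS subn0 /=.
have [|P [f []]] := @good_partial_total G d.+1 d set0 (fun=> ord0) (ltnSn d) noK.
  by split=> [X|X|X|D _ _ X]; rewrite inE.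
exact: defective_of_total.
Qed.
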